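(* Let $T$ be a cyclic bounded linear operator on a complex separable Hilbert space $\mathcal H$ with a cyclic vector $x\in\ker T^*$. Then $T$ is circular if and only if $\{T^nx\}_{n\in\mathbb N}$ is a sequence of mutually orthogonal vectors.
   Context: $\mathbb N$ denotes the set of non-negative integers and $\mathbb T=\{\lambda\in\mathbb C:|\lambda|=1\}$. A bounded linear operator $T$ on a complex Hilbert space $\mathcal H$ is circular if for each $\lambda\in\mathbb T$ there exists a unitary operator $U_\lambda$ on $\mathcal H$ such that $U_\lambda T=\lambda TU_\lambda$. A vector $x$ is cyclic for $T$ if the closed linear span of $\{T^nx:n\in\mathbb N\}$ is $\mathcal H$; $T$ is cyclic if it has a cyclic vector. *)

(* Defs.v *)
From HB Require Import structures.
From mathcomp Require Import all_boot all_order all_algebra.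
From mathcomp Require Import all_classical all_reals.
From mathcomp Require Import topology normedtype.
From mathcomp.real_closed Require Import complex.

Set Implicit Arguments.
Unset Strict Implicit.
Unset Printing Implicit Defensive.

Import Order.TTheory GRing.Theory Num.Theory numFieldNormedType.Exports.

Local Open Scope classical_set_scope.
Local Open Scope ring_scope.
Local Open Scope complex_scope.

(* A complex Hilbert space is a complete normed space over R[i] whose norm
   comes from an inner product, linear in its first argument and
   conjugate-linear in the second. The zero space is allowed. *)
HB.mixin Record NormedModule_isHilbert (R : realType) H
    of CompleteNormedModule R[i] H := {
  inner : {dot H for (@Num.conj R[i])} ;
  innerE : forall u : H, inner u u = `|u| ^+ 2
}.

#[short(type="hilbertType")]
HB.structure Definition Hilbert (R : realType) :=
  {H of NormedModule_isHilbert R H & CompleteNormedModule R[i] H}.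

Definition separable (T : topologicalType) : Prop :=
  exists2 D : set T, countable D & dense D.

Section Operators.
Variables (R : realType) (H : hilbertType R).
Implicit Types (T U : {linear H -> H}) (x u v w : H).

Definition bounded_operator T : Prop :=
  exists M : R[i], forall u, `|T u| <= M * `|u|.

(* adjoint T v is the vector w such that <T u, v> = <u, w> for all u. There is
   at most one; when T is bounded it exists by the Riesz representation
   theorem, so that the default value 0 is not used. *)
Definition adjoint T : H -> H :=
  fun v => xget 0 [set w | forall u, inner (T u) v = inner u w].

Definition unitary U : Prop :=
  [/\ bounded_operator U,
      forall u, adjoint U (U u) = u &
      forall u, U (adjoint U u) = u].

Definition circular T : Prop :=
  forall lambda : R[i], `|lambda| = 1 ->
    exists2 U : {linear H -> H}, unitary U &
      forall u, U (T u) = lambda *: T (U u).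

Definition linear_span (A : set H) : set H :=
  [set v | exists (n : nat) (a : 'I_n -> R[i]) (e : 'I_n -> H),
     (forall i, A (e i)) /\ v = \sum_(i < n) a i *: e i].

Definition cyclic_vector T x : Prop :=
  closure (linear_span (range (fun n : nat => iter n T x))) = setT.

Definition mutually_orthogonal (y : nat -> H) : Prop :=
  forall m n : nat, m <> n -> inner (y m) (y n) = 0.

End Operators.

(* Main.v *)
(* Since <Tu, x> = 0 for all u and x is cyclic, the orthogonal complement of
   the range of T is spanned by x. If U T = a T U with U unitary, then U maps
   this complement to itself, so U x = c x and U (T^n x) = c a^n T^n x; as U
   preserves inner products, <T^m x, T^n x> is fixed by multiplication by
   a^(m-n), hence zero when a^(m-n) = -1 for a suitable unit a. Conversely,
   when the T^n x are orthogonal, the families T^n x and a^n T^n x have the same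
   Gram matrix and are both total, so a unitary operator maps one to the other. *)
Require Import Defs.
From HB Require Import structures.
From mathcomp Require Import all_boot all_order all_algebra.
From mathcomp Require Import all_classical all_reals.
From mathcomp Require Import topology normedtype interval_inference.
From mathcomp.real_closed Require Import complex.
From mathcomp Require Import zify lra.

Set Implicit Arguments.
Unset Strict Implicit.
Unset Printing Implicit Defensive.

Import Order.TTheory GRing.Theory Num.Theory numFieldNormedType.Exports.

Local Open Scope classical_set_scope.
Local Open Scope ring_scope.

(** * Norms with values in [R], and inequalities extended from dense sets *)

Section RealNorm.
Context {R : realType} {V : normedModType R[i]}.
Implicit Types u v w : V.

(** [|u|] lives in [R[i]], whose order is only partial; its real part allows real arithmetic. *)
Definition rnorm u : R := complex.Re `|u|.

Lemma rnormE u : `|u| = (rnorm u)%:C%C.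
Proof. by rewrite RRe_real// normr_real. Qed.

Lemma rnorm_ge0 u : 0 <= rnorm u.
Proof. by rewrite -lecR -rnormE normr_ge0. Qed.

Lemma rnorm0_eq0 u : rnorm u = 0 -> u = 0.
Proof. by move=> u0; apply/normr0_eq0; rewrite rnormE u0. Qed.

Lemma rnorm0 : rnorm 0 = 0.
Proof. by rewrite /rnorm normr0. Qed.

Lemma rnormD u v : rnorm (u + v) <= rnorm u + rnorm v.
Proof. by rewrite -lecR rmorphD/= -!rnormE ler_normD. Qed.

Lemma rdistC u v : rnorm (u - v) = rnorm (v - u).
Proof. by rewrite /rnorm distrC. Qed.

Lemma rdist_triangle w u v : rnorm (u - v) <= rnorm (u - w) + rnorm (w - v).
Proof. by rewrite (le_trans _ (rnormD _ _))// addrA subrK. Qed.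

Lemma rnormB_ge u v : rnorm u <= rnorm v + rnorm (u - v).
Proof. by rewrite (le_trans _ (rnormD _ _))// addrCA subrr addr0. Qed.

Lemma closure_approx (D : set V) u (d : R) :
  closure D u -> 0 < d -> exists2 s, D s & rnorm (u - s) <= d.
Proof.
move=> Du d0; have d0' : 0 < d%:C%C by rewrite ltcR.
have [s [Ds]] := Du _ (nbhsx_ballx u _ d0').
by rewrite -ball_normE/= rnormE ltcR => /ltW ?; exists s.
Qed.

(** Moving from [u] to a point of [D] within [e / (|K| + 1)] costs at most [e]; the [+ 1] avoids
    dividing by zero. *)
Lemma dense_le0 (D : set V) (f : V -> R) (K : R) :
  closure D = setT -> (forall u v, f u <= f v + K * rnorm (u - v)) ->
  (forall s, D s -> f s <= 0) -> forall u, f u <= 0.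
Proof.
move=> DT fK fD u; apply/ler_addgt0Pr => e e0; rewrite add0r.
have [||s Ds us] := @closure_approx D u (e / (`|K| + 1)).
- by rewrite DT.
- by apply: divr_gt0 => //; rewrite ltr_wpDl.
apply: le_trans (fK u s) _.
have K1 : K * rnorm (u - s) <= (`|K| + 1) * rnorm (u - s).
  by rewrite ler_wpM2r ?rnorm_ge0// (le_trans (ler_norm K))// lerDl.
have K2 : (`|K| + 1) * rnorm (u - s) <= e.
  by rewrite mulrC -ler_pdivlMr// ltr_wpDl.
have := fD s Ds; lra.
Qed.

End RealNorm.

(** Witnesses at precision [1/(n+1)] form a Cauchy sequence by the diameter bound, and completeness
    gives the limit. It serves both minimising sequences and the transport of limits between
    families. *)
Lemma approximants_converge (R : realType) (V : completeNormedModType R[i])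
    (P : R -> V -> Prop) :
  (forall d : R, 0 < d -> exists w, P d w) ->
  (forall (d d' : R) w w', 0 < d -> 0 < d' -> P d w -> P d' w' ->
    rnorm (w - w') <= d + d') ->
  exists w, forall (d : R) w', 0 < d -> P d w' -> rnorm (w' - w) <= d.
Proof.
move=> exP diamP.
have pos n : 0 < n.+1%:R^-1 :> R by rewrite invr_gt0.
have [u uP] := choice (fun n : nat => exP n.+1%:R^-1 (pos n)).
have small (e : R) : 0 < e -> \forall n \near \oo, n.+1%:R^-1 < e.
  by move=> e0; exact: (near_infty_natSinv_lt (PosNum e0)).
have ucvg : cvg (u @ \oo).
  apply/cauchy_cvgP/cauchyP => e e0.
  have eE : e = (complex.Re e)%:C%C by rewrite RRe_real// gtr0_real.
  move: e0; rewrite eE ltcR => e0.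
  have e20 : 0 < complex.Re e / 2 by rewrite divr_gt0.
  have [N _ /(_ N (leqnn N)) Ne] := small _ e20.
  exists (u N).
  suff : \forall n \near \oo, ball (u N) (complex.Re e)%:C%C (u n) by [].
  near=> n.
  rewrite -ball_normE/= rnormE ltcR.
  apply: le_lt_trans (diamP _ _ _ _ (pos N) (pos n) (uP N) (uP n)) _.
  rewrite [ltRHS]splitr ltrD//.
  by near: n; exact: small.
exists (lim (u @ \oo)) => d w' d0 Pw'; apply/ler_addgt0Pr => e e0.
have e20 : 0 < e / 2 by rewrite divr_gt0.
have [n [ne nl]] : exists n, n.+1%:R^-1 < e / 2 /\
    rnorm (u n - lim (u @ \oo)) < e / 2.
  have e20' : 0 < (e / 2)%:C%C by rewrite ltcR.
  have ul : \forall n \near \oo, `|lim (u @ \oo) - u n| < (e / 2)%:C%C.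
    by move/cvgrPdist_lt : ucvg; exact.
  near \oo => n; exists n; split; first by near: n; exact: small.
  by rewrite -ltcR -rnormE distrC; near: n.
rewrite (le_trans (rdist_triangle (u n) _ _))// [e]splitr addrA lerD ?(ltW nl)//.
by rewrite (le_trans (diamP _ _ _ _ d0 (pos n) Pw' (uP n)))// lerD2l ltW.
Unshelve. all: by end_near. Qed.

(** * The underlying real inner product and the Cauchy-Schwarz inequality *)

Section RealInner.
Context {R : realType} {H : hilbertType R}.
Implicit Types u v w : H.

Definition rinner u v : R := complex.Re (inner u v).

Lemma innerDl u v w : inner (u + v) w = inner u w + inner v w.
Proof. exact: linearDl. Qed.

Lemma innerBl u v w : inner (u - v) w = inner u w - inner v w.
Proof. exact: linearBl. Qed.

Lemma innerZl a u v : inner (a *: u) v = a * inner u v.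
Proof. exact: linearZl_LR. Qed.

Lemma innerZr a u v : inner u (a *: v) = (a^*)%C * inner u v.
Proof. exact: linearZr_LR. Qed.

Lemma inner0l u : inner 0 u = 0.
Proof. exact: linear0l. Qed.

Lemma innerC u v : inner u v = ((inner v u)^*)%C.
Proof. by rewrite hermC expr0 mul1r. Qed.

(** [a = 1] recovers the real part and [a = 'i] the imaginary part, so complex identities reduce to
    real ones. *)
Lemma inner_ext u v u' v' :
  (forall a, rinner u (a *: v) = rinner u' (a *: v')) -> inner u v = inner u' v'.
Proof.
move=> uv; have := uv 'i%C; have := uv 1.
rewrite /rinner !innerZr; case: (inner u v) (inner u' v') => [a b] [c d].
move=> /= ac bd; have -> : a = c by lra.
by have -> : b = d by lra.
Qed.

Lemma rinnerC u v : rinner u v = rinner v u.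
Proof. by rewrite /rinner (innerC u v); case: (inner v u). Qed.

Lemma rinnerDl u v w : rinner (u + v) w = rinner u w + rinner v w.
Proof. by rewrite /rinner innerDl raddfD. Qed.

Lemma rinnerDr u v w : rinner w (u + v) = rinner w u + rinner w v.
Proof. by rewrite ![rinner w _]rinnerC rinnerDl. Qed.

Lemma rinnerZl (a : R) u v : rinner (a%:C%C *: u) v = a * rinner u v.
Proof. by rewrite /rinner innerZl; case: (inner u v) => b c /=; rewrite mul0r subr0. Qed.

Lemma rinnerZr (a : R) u v : rinner u (a%:C%C *: v) = a * rinner u v.
Proof. by rewrite rinnerC rinnerZl rinnerC. Qed.

Lemma rinnerNl u v : rinner (- u) v = - rinner u v.
Proof. by rewrite -scaleN1r (_ : -1 = (-1)%:C%C) ?rinnerZl ?mulN1r// rmorphN. Qed.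

Lemma rinnerNr u v : rinner u (- v) = - rinner u v.
Proof. by rewrite rinnerC rinnerNl rinnerC. Qed.

Lemma rinner0l u : rinner 0 u = 0.
Proof. by rewrite /rinner inner0l. Qed.

Definition rinnerE := (rinnerDl, rinnerDr, rinnerNl, rinnerNr, rinnerZl, rinnerZr).

Lemma rnorm_sqr u : rnorm u ^+ 2 = rinner u u.
Proof. by rewrite /rinner innerE rnormE -rmorphXn. Qed.

Lemma rinner_eq0 u : rinner u u <= 0 -> u = 0.
Proof.
rewrite -rnorm_sqr => u0; apply: rnorm0_eq0; apply/eqP.
by rewrite -(@sqrf_eq0 R) eq_le u0 sqr_ge0.
Qed.

Lemma rinner_le u v : rinner u v <= rnorm u * rnorm v.
Proof.
have [->|v0] := eqVneq v 0; first by rewrite rinnerC rinner0l rnorm0 mulr0.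
have nv : 0 < rnorm v.
  by rewrite lt_def rnorm_ge0 andbT; apply: contra_neq v0; exact: rnorm0_eq0.
pose a := rnorm v; pose b := rnorm u.
(* The square expands to [2ab(ab - rinner u v)], to be divided by [2ab] when [b] is positive. *)
have := sqr_ge0 (rnorm (a%:C%C *: u - b%:C%C *: v)).
rewrite rnorm_sqr !rinnerE -!rnorm_sqr -/a -/b (rinnerC v u) => h.
have := rnorm_ge0 u; rewrite -/b le_eqVlt => /predU1P[b0|b0]; last first.
  have := mulr_gt0 nv b0; rewrite -/a; nra.
have -> : u = 0 by apply: rnorm0_eq0; rewrite -/b -b0.
by rewrite rinner0l -b0 mul0r.
Qed.

End RealInner.

(** * Riesz representation of bounded real-linear functionals *)

Section Riesz.
Context {R : realType} {H : hilbertType R}.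
Implicit Types u v w : H.

(* The representing vector is the limit of minimising sequences of
   [u |-> |u|^2 - 2 f u]; these are Cauchy by the parallelogram identity. *)
Lemma riesz_representation (f : H -> R) (K : R) :
  (forall u v, f (u + v) = f u + f v) ->
  (forall (a : R) u, f (a%:C%C *: u) = a * f u) ->
  (forall u, f u <= K * rnorm u) ->
  exists w, forall u, f u = rinner u w.
Proof.
move=> fD fZ fK; pose J u := rinner u u - 2 * f u.
have f0 : f 0 = 0 by have := fD 0 0; rewrite addr0; lra.
have fN u : f (- u) = - f u by have := fD u (- u); rewrite subrr f0; lra.
have Jinf : has_inf (range J).
  split; first by exists (J 0), 0.
  (* [J u] is at least [|u|^2 - 2K|u| = (|u| - K)^2 - K^2]. *)
  exists (- K ^+ 2) => _ [u _ <-]; rewrite /J -rnorm_sqr.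
  have := fK u; have := sqr_ge0 (rnorm u - K); nra.
pose m := inf (range J).
have mJ u : m <= J u by apply: ge_inf; [case: Jinf|exists u].
(* With this tolerance, [|u - v|^2 = 2 J u + 2 J v - 4 J ((u + v)/2)] is at most [d^2 + d'^2], hence
   at most [(d + d')^2]. *)
pose P (d : R) u := J u <= m + d ^+ 2 / 2.
have [d d0||w wP] := @approximants_converge R H P.
- have d20 : 0 < d ^+ 2 / 2 by rewrite divr_gt0// exprn_gt0.
  by have [_ [u _ <-] /ltW ?] := inf_adherent d20 Jinf; exists u.
- move=> d d' u v d0 d'0; rewrite /P /J => Pu Pv.
  have := mJ ((2^-1)%:C%C *: (u + v)).
  rewrite /J !rinnerE fZ fD (rinnerC v u) => mid.
  have dd0 : 0 <= d + d' by rewrite addr_ge0// ltW.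
  rewrite -(ler_pXn2r (ltn0Sn 1)) ?nnegrE ?rnorm_ge0// rnorm_sqr !rinnerE (rinnerC v u).
  have := mulr_gt0 d0 d'0; nra.
(* Comparing a near-minimiser [u] with [u + d v] and dividing by [2d] bounds [f v - rinner u v] by
   [d/4 + d|v|^2/2]; replacing [u] by [w] costs [d|v|]. [C] makes the total at most [e]. *)
have le_f v : f v <= rinner v w.
  apply/ler_addgt0Pr => e e0.
  pose C := 1 + rinner v v + rnorm v.
  have C0 : 0 < C.
    have := rnorm_ge0 v; have := sqr_ge0 (rnorm v); rewrite rnorm_sqr /C; lra.
  pose d := e / C.
  have d0 : 0 < d by exact: divr_gt0.
  have d20 : 0 < d ^+ 2 / 2 by rewrite divr_gt0// exprn_gt0.
  have [_ [u _ <-] /ltW Ju] := inf_adherent d20 Jinf.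
  have uw := wP d u d0 Ju.
  have := rinner_le (u - w) v; have := mJ (u + d%:C%C *: v).
  move: Ju; rewrite -/m /J !rinnerE fD fZ (rinnerC w v) (rinnerC v u) => Ju mu uwv.
  have h1 : rnorm (u - w) * rnorm v <= d * rnorm v by rewrite ler_wpM2r// rnorm_ge0.
  have h2 : 0 <= d * (d / 2 + 2 * (rinner u v - f v) + d * rinner v v) by nra.
  rewrite pmulr_rge0// in h2.
  have h3 : d * C = e by rewrite divfK// gt_eqF.
  rewrite /C in h3; have := rnorm_ge0 v; have := sqr_ge0 (rnorm v); rewrite rnorm_sqr.
  nra.
exists w => v; apply/eqP; rewrite eq_le le_f/=.
by have := le_f (- v); rewrite fN rinnerNl lerN2.
Qed.

End Riesz.

(** * Adjoints, unitary operators and total families *)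

Section Operators.
Context {R : realType} {H : hilbertType R}.
Implicit Types (T U : {linear H -> H}) (u v w : H).

Lemma bounded_operatorP T : bounded_operator T ->
  exists2 K : R, 0 <= K & forall u, rnorm (T u) <= K * rnorm u.
Proof.
move=> [M TM]; exists `|complex.Re M| => // u.
have : complex.Re `|T u| <= complex.Re (M * `|u|).
  by have := TM u; rewrite lecE => /andP[].
rewrite [in leRHS]rnormE; case: M {TM} => a b /=; rewrite mulr0 subr0 => h.
by rewrite (le_trans h)// ler_wpM2r ?rnorm_ge0// ler_norm.
Qed.

Lemma inner_inj v w : (forall u, inner u v = inner u w) -> v = w.
Proof.
move=> vw; apply/subr0_eq/rinner_eq0; rewrite /rinner.
by rewrite [inner _ _]linearBr/= vw subrr.
Qed.

Lemma adjointE T v w : (forall u, inner (T u) v = inner u w) -> adjoint T v = w.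
Proof.
move=> Tw; rewrite /adjoint; case: xgetP => [y _ Ty|/(_ w)//].
by apply: inner_inj => u; rewrite -Ty Tw.
Qed.

(** Riesz represents the real part of [inner (T u) v]; complex linearity of [T] then gives the full
    identity, so [adjoint] takes no default value here. *)
Lemma adjointP T u v : bounded_operator T -> inner (T u) v = inner u (adjoint T v).
Proof.
move=> /bounded_operatorP[K K0 TK].
pose f u := rinner (T u) v.
have [|||w fw] := @riesz_representation R H f (K * rnorm v).
- by move=> ? ?; rewrite /f linearD rinnerDl.
- by move=> a ?; rewrite /f linearZ rinnerZl.
- move=> u'; rewrite (le_trans (rinner_le _ _))// mulrAC.
  by rewrite ler_wpM2r ?rnorm_ge0.
have Tw u' : inner (T u') v = inner u' w.
  rewrite [LHS]innerC [RHS]innerC; congr conjc; apply: inner_ext => a.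
  by rewrite -linearZ rinnerC [RHS]rinnerC -fw.
by rewrite (adjointE Tw).
Qed.

Lemma inner_unitary U u v : unitary U -> inner (U u) (U v) = inner u v.
Proof. by move=> [Ub UadjU _]; rewrite adjointP// UadjU. Qed.

(** Polarisation: expanding [|U (u + v)|^2] shows that [U] preserves inner products, so its adjoint
    is a left inverse, and surjectivity makes it two-sided. *)
Lemma surjective_isometry_unitary U :
  (forall u, rnorm (U u) = rnorm u) -> (forall v, exists u, U u = v) -> unitary U.
Proof.
move=> Un Usurj.
have Ur u v : rinner (U u) (U v) = rinner u v.
  have := congr1 (fun z => z ^+ 2) (Un (u + v)); rewrite linearD !rnorm_sqr !rinnerE.
  rewrite -!rnorm_sqr !Un (rinnerC v) (rinnerC (U v)); lra.
have Ui u v : inner (U u) (U v) = inner u v.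
  by apply: inner_ext => a; rewrite -linearZ Ur.
have Uadj u : adjoint U (U u) = u by apply: adjointE => v; rewrite Ui.
split=> //; last by move=> v; have [u <-] := Usurj v; rewrite Uadj.
by exists 1 => u; rewrite mul1r !rnormE Un.
Qed.

Lemma linear_span_ind (A : set H) (P : H -> Prop) :
  P 0 -> (forall a e u, A e -> P u -> P (a *: e + u)) ->
  forall v, linear_span A v -> P v.
Proof.
move=> P0 PS _ [n [a [e [Ae ->]]]].
by elim/big_rec: _ => // i u _ Pu; apply: PS.
Qed.

Section Total.
Variables (e : nat -> H).
Hypothesis e_total : closure (linear_span (range e)) = setT.

(** For [d = u - v], the Lipschitz map [s |-> rinner s d] vanishes on the span, hence is at most 0
    at [d] itself. *)
Lemma total_eq u v : (forall n, inner u (e n) = inner v (e n)) -> u = v.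
Proof.
move=> uv; apply/subr0_eq/rinner_eq0; set d := u - v.
apply: (dense_le0 (f := fun s => rinner s d) (K := rnorm d) e_total).
- move=> s t; rewrite -{1}(subrK t s) rinnerDl addrC lerD2l mulrC.
  exact: rinner_le.
- apply: linear_span_ind => [|a _ s [n _ <-] sd]; first by rewrite rinner0l.
  rewrite rinnerDl rinnerC /rinner innerZr innerBl uv subrr mulr0 add0r.
  exact: sd.
Qed.

Lemma total_operator_eq T U : bounded_operator T -> bounded_operator U ->
  (forall n, T (e n) = U (e n)) -> T =1 U.
Proof.
move=> /bounded_operatorP[K K0 TK] /bounded_operatorP[L L0 UL] TU u.
apply/subr0_eq/rnorm0_eq0/eqP; rewrite eq_le rnorm_ge0 andbT.
apply: (dense_le0 (f := fun s => rnorm (T s - U s)) (K := K + L) e_total).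
- move=> s t; apply: le_trans (rnormB_ge _ (T t - U t)) _; rewrite lerD2l.
  have -> : T s - U s - (T t - U t) = T (s - t) + U (t - s).
    by rewrite (linearB T) (linearB U) opprB addrACA [RHS]addrACA [- U s + _]addrC.
  by rewrite mulrDl (le_trans (rnormD _ _))// (rdistC s) lerD// rdistC.
- apply: linear_span_ind => [|a _ s [n _ <-] sd].
    by rewrite (linear0 T) (linear0 U) subrr rnorm0.
  by rewrite (linearP T) (linearP U) /= TU opprD addrACA subrr add0r.
Qed.

End Total.

(** Coefficients are kept as a list because the vector need not determine them, and the same list
    must be used for two families. *)
Definition combination (e : nat -> H) (p : seq (nat * R[i])) : H :=
  \sum_(x <- p) x.2 *: e x.1.

Lemma combination_cons (e : nat -> H) x p :
  combination e (x :: p) = x.2 *: e x.1 + combination e p.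
Proof. exact: big_cons. Qed.

Lemma linear_span_combination (e : nat -> H) v :
  linear_span (range e) v -> exists p, v = combination e p.
Proof.
move: v; apply: linear_span_ind; first by exists [::]; rewrite /combination big_nil.
by move=> a _ _ [n _ <-] [p ->]; exists ((n, a) :: p); rewrite combination_cons.
Qed.

(** * Families with the same Gram matrix *)

Section Gram.
Variables (e f : nat -> H).
Hypothesis gram : forall m n, inner (e m) (e n) = inner (f m) (f n).

Lemma inner_combination p q :
  inner (combination e p) (combination e q) = inner (combination f p) (combination f q).
Proof.
elim: p => [|x p IHp]; first by rewrite /combination !big_nil !inner0l.
rewrite !combination_cons !innerDl !innerZl IHp; congr (_ * _ + _) => {p IHp}.
rewrite innerC [RHS]innerC; congr conjc.
elim: q => [|y q IHq]; first by rewrite /combination !big_nil !inner0l.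
by rewrite !combination_cons !innerDl !innerZl IHq gram.
Qed.

Lemma rdist_combination p q :
  rnorm (combination e p - combination e q) = rnorm (combination f p - combination f q).
Proof.
apply/eqP; rewrite -(@eqrXn2 _ 2)// ?rnorm_ge0// !rnorm_sqr !rinnerE.
by rewrite /rinner !inner_combination.
Qed.

Hypothesis e_total : closure (linear_span (range e)) = setT.

(* [w] is the limit of [combination f p] as [combination e p] tends to [u]. *)
Lemma gram_transfer u : exists w, rnorm w = rnorm u /\
  forall n, inner w (f n) = inner u (e n).
Proof.
pose P (d : R) w := exists p, w = combination f p /\ rnorm (u - combination e p) <= d.
have exP d : 0 < d -> exists w, P d w.
  move=> d0; have [||s /linear_span_combination[p ->] us] :=
    @closure_approx _ _ (linear_span (range e)) u d; rewrite ?e_total//.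
  by exists (combination f p), p.
have [|w wP] := approximants_converge exP.
  move=> d d' _ _ d0 d'0 [p [-> up]] [q [-> uq]].
  rewrite -rdist_combination (le_trans (rdist_triangle u _ _))// lerD//.
  by rewrite rdistC.
have wp d : 0 < d -> exists p,
    rnorm (u - combination e p) <= d /\ rnorm (combination f p - w) <= d.
  move=> d0; have [w' [p [_ up]]] := exP d d0.
  by exists p; split=> //; apply: wP => //; exists p.
have np p : rnorm (combination f p) = rnorm (combination e p).
  have := rdist_combination p [::].
  by rewrite {2 4}/combination !big_nil !subr0.
exists w; split.
  apply/eqP; rewrite eq_le; apply/andP; split; apply/ler_addgt0Pr => d d0.
  - have [|p [up pw]] := wp (d / 2); first by rewrite divr_gt0.
    have := rnormB_ge w (combination f p); have := rnormB_ge (combination e p) u.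
    rewrite rdistC (rdistC w) np; lra.
  - have [|p [up pw]] := wp (d / 2); first by rewrite divr_gt0.
    have := rnormB_ge u (combination e p); have := rnormB_ge (combination f p) w.
    rewrite np; lra.
move=> n; apply: inner_ext => a.
(* On a common [p] both sides agree, and the two approximation errors add up to at most [d]. Taking
   [-a] for [b] later gives the reverse inequality. *)
have le_inner b : rinner w (b *: f n) <= rinner u (b *: e n).
  apply/ler_addgt0Pr => d d0; set F := b *: f n; set E := b *: e n.
  pose C := rnorm F + rnorm E + 1.
  have C0 : 0 < C by rewrite ltr_wpDl// addr_ge0// rnorm_ge0.
  have [p [up pw]] := wp (d / C) (divr_gt0 d0 C0).
  have FE : rinner (combination f p) F = rinner (combination e p) E.
    have := inner_combination p [:: (n, b)].
    by rewrite /combination !big_seq1 /= /rinner => ->.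
  have := rinner_le (w - combination f p) F; have := rinner_le (combination e p - u) E.
  rewrite !rinnerE FE (rdistC w) (rdistC _ u) => h1 h2.
  have h3 := ler_wpM2r (rnorm_ge0 F) pw; have h4 := ler_wpM2r (rnorm_ge0 E) up.
  have h5 : d / C * (rnorm F + rnorm E) <= d.
    rewrite -[leRHS](@divfK _ C) ?gt_eqF// ler_wpM2l ?ltW ?divr_gt0//.
    by rewrite ltrDl.
  lra.
apply/eqP; rewrite eq_le le_inner/=.
by have := le_inner (- a); rewrite !scaleNr !rinnerNr lerN2.
Qed.

End Gram.

(** Inner products with the total family [f] determine the transferred vector, so the choice is
    linear; transfer from [f] back to [e] gives surjectivity. *)
Lemma gram_unitary (e f : nat -> H) :
  (forall m n, inner (e m) (e n) = inner (f m) (f n)) ->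
  closure (linear_span (range e)) = setT -> closure (linear_span (range f)) = setT ->
  exists2 U : {linear H -> H}, unitary U & forall n, U (e n) = f n.
Proof.
move=> gram etot ftot.
have [U UP] := choice (gram_transfer gram etot).
have Ulin : linear U.
  move=> a u v; apply: (total_eq ftot) => n.
  by rewrite innerDl innerZl !(UP _).2 innerDl innerZl.
pose mU := GRing.isLinear.Build _ _ _ _ U Ulin.
pose V : {linear H -> H} := HB.pack U mU.
exists V; last by move=> n; apply: (total_eq ftot) => k; rewrite (UP _).2 gram.
apply: surjective_isometry_unitary => [u|v]; first exact: (UP u).1.
have [u [_ uP]] := gram_transfer (fun m n => esym (gram m n)) ftot v.
by exists u; apply: (total_eq ftot) => n; rewrite (UP _).2 uP.
Qed.

End Operators.

(** * Circular operators and orbits of cyclic vectors *)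

Lemma iter_circular (R : realType) (H : hilbertType R) (T U : {linear H -> H})
    (a c : R[i]) (x : H) (n : nat) :
  (forall u, U (T u) = a *: T (U u)) -> U x = c *: x ->
  U (iter n T x) = (c * a ^+ n) *: iter n T x.
Proof.
move=> UT Ux; elim: n => [|n IHn]; first by rewrite mulr1.
by rewrite iterS UT IHn linearZ/= scalerA exprS mulrCA.
Qed.

Lemma unit_root_N1 (R : realType) (k : nat) : (0 < k)%N ->
  exists2 a : R[i], `|a| = 1 & a ^+ k = -1.
Proof.
move=> k0; exists (k.-root (-1)); last by rewrite rootCK.
apply/eqP; have := pexprn_eq1 k (normr_ge0 (k.-root (-1 : R[i]))).
by rewrite -normrX rootCK// normrN1 eqxx eqn0Ngt k0.
Qed.

Theorem corollary2p2 (R : realType) (H : hilbertType R)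
  (Hsep : separable H)
  (T : {linear H -> H}) (Tbounded : bounded_operator T)
  (x : H) (xcyclic : cyclic_vector T x) (xker : adjoint T x = 0) :
  circular T <-> mutually_orthogonal (fun n : nat => iter n T x).
Proof.
have Tx u : inner (T u) x = 0 by rewrite adjointP// xker linear0r.
split=> [Tcirc|Torth]; last first.
  move=> a a1; have a0 : a != 0 by rewrite -normr_eq0 a1 oner_eq0.
  have aaC : a * a^*%C = 1 by rewrite -normCK a1 expr1n.
  pose f n := a ^+ n *: iter n T x.
  have gram m n : inner (iter m T x) (iter n T x) = inner (f m) (f n).
    (* On the diagonal the scalars cancel since [a] has modulus 1; elsewhere both sides vanish by
       orthogonality. *)
    rewrite /f innerZl innerZr; have [<-|/eqP mn] := eqVneq m n.
      by rewrite mulrA rmorphXn -exprMn aaC expr1n mul1r.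
    by rewrite Torth// !mulr0.
  have span_f : linear_span (range (fun n => iter n T x)) `<=` linear_span (range f).
    move=> _ [n [b [e [eT ->]]]].
    have /choice[k ke] : forall i, exists j, iter j T x = e i.
      by move=> i; have [j _] := eT i; exists j.
    exists n, (fun i => b i / a ^+ k i), (fun i => f (k i)); split.
      by move=> i; exists (k i).
    apply: eq_bigr => i _.
    by rewrite -ke /f scalerA divfK// expf_neq0.
  have ftot : closure (linear_span (range f)) = setT.
    by apply/seteqP; split=> // u _; apply: (closure_subset span_f); rewrite xcyclic.
  have [U Uunit Ue] := gram_unitary gram xcyclic ftot.
  exists U => // u; have [Ub _ _] := Uunit.
  pose aTU : {linear H -> H} := a \*: (T \o U).
  have [K K0 TK] := bounded_operatorP Tbounded.
  have [L L0 UL] := bounded_operatorP Ub.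
  have bnd M (S : {linear H -> H}) :
      (forall u, rnorm (S u) <= M * rnorm u) -> bounded_operator S.
    by move=> SM; exists M%:C%C => v; rewrite !rnormE -rmorphM lecR.
  (* Both operators send [T^n x] to [a^(n+1) T^(n+1) x]. *)
  apply: (@total_operator_eq R H _ xcyclic (U \o T) aTU).
  - apply: (bnd (L * K)) => v.
    by rewrite (le_trans (UL _))// -mulrA ler_wpM2l.
  - apply: (bnd (K * L)) => v.
    rewrite /= -lecR -rnormE normrZ a1 mul1r rnormE lecR.
    by rewrite (le_trans (TK _))// -mulrA ler_wpM2l.
  - by move=> n /=; rewrite -iterS !Ue /f linearZ/= scalerA exprS.
move=> m n; wlog mn : m n / (m < n)%N => [wlogmn|_].
  move=> /eqP; rewrite neq_ltn => /orP[?|?]; first by apply: wlogmn => //; lia.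
  by rewrite innerC wlogmn ?conjc0//; lia.
(* The case [x = 0] is set apart because [c] below divides by [inner x x]. *)
have [x0|x0] := eqVneq (inner x x) 0.
  have -> : x = 0 by apply: rinner_eq0; rewrite /rinner x0.
  have -> : iter m T 0 = 0 by elim: m {mn} => //= m ->; rewrite linear0.
  exact: inner0l.
have [a a1 ak] := @unit_root_N1 R (n - m) ltac:(by rewrite subn_gt0).
have [U Uunit UT] := Tcirc a a1; have [_ _ UadjU] := Uunit.
have a0 : a != 0 by rewrite -normr_eq0 a1 oner_eq0.
have aaC : a * a^*%C = 1 by rewrite -normCK a1 expr1n.
(* The coefficient of the orthogonal projection of [U x] onto [x]. *)
pose c := inner (U x) x / inner x x.
(* With [z = adjoint U y], [T y = T (U z) = a^-1 U (T z)], and [U] carries the orthogonality of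
   [T z] and [x] to [U (T z)] and [U x]. *)
have TUx y : inner (T y) (U x) = 0.
  rewrite -(UadjU y); have /(congr1 (fun v => a^-1 *: v)) := UT (adjoint U y).
  by rewrite scalerA mulVf// scale1r => <-; rewrite innerZl inner_unitary// Tx mulr0.
(* The two sides have equal inner products with [x] by the choice of [c], and both are orthogonal to
   every later [T^(j+1) x]. *)
have Ux : U x = c *: x.
  apply: (total_eq xcyclic) => -[|j]; first by rewrite /= innerZl divfK.
  by rewrite iterS innerZl innerC TUx (innerC x) Tx conjc0 mulr0.
have ccC : c * c^*%C = 1.
  apply: (mulIf x0); rewrite mul1r -{2}(inner_unitary x x Uunit) Ux.
  by rewrite innerZl innerZr mulrA.
have := inner_unitary (iter m T x) (iter n T x) Uunit.
rewrite !(iter_circular _ UT Ux) innerZl innerZr.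
set g := inner _ _.
(* The moduli of [c] and [a^m] are 1, which leaves the conjugate of [a^(n-m) = -1]; thus
   [g = -g]. *)
have -> : c * a ^+ m * ((c * a ^+ n)^*%C * g) = - g.
  rewrite -(subnKC (ltnW mn)) exprD ak mulrN1 mulrN rmorphN/= rmorphM rmorphXn/=.
  rewrite mulNr mulrN; congr (- _).
  by rewrite mulrA mulrACA ccC mul1r -exprMn aaC expr1n mul1r.
by move=> /eqP; rewrite eq_sym -addr_eq0 -mulr2n mulrn_eq0 => /eqP.
Qed.
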